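(* Let $C_3\approx1.104068697$ be the positive root of $8x^4-36x^3+113x^2-69x-25$. For every triangle, the following bounds hold, where a bound $L\le \frac{D(n,i)}{D(n,j)}\le U$ means $L\,D(n,j)\le D(n,i)\le U\,D(n,j)$ (and similarly for one-sided bounds and equalities): $$\frac{D(4,1)}{D(4,2)}\le1,\quad \frac{D(4,1)}{D(4,3)}\le\frac23,\quad \frac{D(4,1)}{D(4,5)}\le\frac43,\quad 1\le\frac{D(4,1)}{D(4,6)},\quad 1\le\frac{D(4,1)}{D(4,7)}\le2,$$ $$\frac{D(4,1)}{D(4,8)}\le1,\quad \frac{D(4,1)}{D(4,9)}\le1,\quad \frac{D(4,1)}{D(4,10)}\le1,$$ $$\frac{D(4,2)}{D(4,3)}=\frac23,\quad \frac{D(4,2)}{D(4,5)}=\frac43,\quad 1\le\frac{D(4,2)}{D(4,6)},\quad 1\le\frac{D(4,2)}{D(4,7)},\quad \frac13\le\frac{D(4,2)}{D(4,8)}\le1,\quad \frac23\le\frac{D(4,2)}{D(4,9)}\le1,\quad \frac23\le\frac{D(4,2)}{D(4,10)}\le1,$$ $$\frac{D(4,3)}{D(4,5)}=2,\quad \frac32\le\frac{D(4,3)}{D(4,6)},\quad \frac32\le\frac{D(4,3)}{D(4,7)},\quad \frac12\le\frac{D(4,3)}{D(4,8)}\le\frac32,\quad 1\le\frac{D(4,3)}{D(4,9)}\le\frac32,\quad 1\le\frac{D(4,3)}{D(4,10)}\le\frac32,$$ $$\frac34\le\frac{D(4,5)}{D(4,6)},\quad \frac34\le\frac{D(4,5)}{D(4,7)},\quad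 \frac14\le\frac{D(4,5)}{D(4,8)}\le\frac34,\quad \frac12\le\frac{D(4,5)}{D(4,9)}\le\frac34,\quad \frac12\le\frac{D(4,5)}{D(4,10)}\le\frac34,$$ $$\frac{D(4,6)}{D(4,7)}\le C_3,\quad \frac{D(4,6)}{D(4,8)}\le1,\quad \frac{D(4,6)}{D(4,9)}\le1,\quad \frac{D(4,6)}{D(4,10)}\le1,$$ $$\frac{D(4,7)}{D(4,8)}\le1,\quad \frac{D(4,7)}{D(4,9)}\le1,\quad \frac{D(4,7)}{D(4,10)}\le1,\quad 1\le\frac{D(4,8)}{D(4,9)}\le2,\quad 1\le\frac{D(4,8)}{D(4,10)}\le2,\quad 1\le\frac{D(4,9)}{D(4,10)}\le\frac{10}9.$$
   Context: For a (nondegenerate) triangle $ABC$ with side lengths $a=BC$, $b=CA$, $c=AB$, a point with barycentric coordinates $(u:v:w)$ is $(uA+vB+wC)/(u+v+w)$. For $1\le n\le 10$ the triangle center $X_n$ is the point with barycentric coordinates $(f_n(a,b,c):f_n(b,c,a):f_n(c,a,b))$, where $f_1=a$ (incenter); $f_2=1$ (centroid); $f_3=a^2(a^2-b^2-c^2)$ (circumcenter); $f_4=(a^2+b^2-c^2)(a^2-b^2+c^2)$ (orthocenter); $f_5=c^4-a^2b^2+b^4-a^2c^2-2b^2c^2$ (nine-point center); $f_6=a^2$ (symmedian point); $f_7=(a+b-c)(a-b+c)$ (Gergonne point); $f_8=a-b-c$ (Nagel point); $f_9=a(a-b-c)$ (mittenpunkt); $f_{10}=b+c$ (Spieker center). $D(i,j)$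 denotes the Euclidean distance between $X_i$ and $X_j$. *)

(* Defs.v *)
From Stdlib Require Import Reals.

Open Scope R_scope.

Definition point : Type := (R * R)%type.

Definition dist (P Q : point) : R :=
  dist_euc (fst P) (snd P) (fst Q) (snd Q).

Definition collinear (P Q S : point) : Prop :=
  exists l m n : R,
    (l <> 0 \/ m <> 0) /\
    l * fst P + m * snd P = n /\
    l * fst Q + m * snd Q = n /\
    l * fst S + m * snd S = n.

Definition is_triangle (A B C : point) : Prop := ~ collinear A B C.

Definition barycentric (A B C : point) (u v w : R) : point :=
  ((u * fst A + v * fst B + w * fst C) / (u + v + w),
   (u * snd A + v * snd B + w * snd C) / (u + v + w)).

(* The value 0 outside 1 <= n <= 10 is a dummy. For each n in that range the
   three cyclic values have a nonzero sum whenever a, b, c are the side lengths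
   of a nondegenerate triangle, so no division by zero occurs in [X] below. *)
Definition f (n : nat) (a b c : R) : R :=
  match n with
  | 1%nat => a
  | 2%nat => 1
  | 3%nat => a ^ 2 * (a ^ 2 - b ^ 2 - c ^ 2)
  | 4%nat => (a ^ 2 + b ^ 2 - c ^ 2) * (a ^ 2 - b ^ 2 + c ^ 2)
  | 5%nat => c ^ 4 - a ^ 2 * b ^ 2 + b ^ 4 - a ^ 2 * c ^ 2 - 2 * b ^ 2 * c ^ 2
  | 6%nat => a ^ 2
  | 7%nat => (a + b - c) * (a - b + c)
  | 8%nat => a - b - c
  | 9%nat => a * (a - b - c)
  | 10%nat => b + c
  | _ => 0
  end.

Definition X (A B C : point) (n : nat) : point :=
  let a := dist B C in
  let b := dist C A in
  let c := dist A B in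
  barycentric A B C (f n a b c) (f n b c a) (f n c a b).

Definition D (A B C : point) (i j : nat) : R := dist (X A B C i) (X A B C j).

Definition is_positive_root (x : R) : Prop :=
  0 < x /\ 8 * x ^ 4 - 36 * x ^ 3 + 113 * x ^ 2 - 69 * x - 25 = 0.

(* Main.v *)
(* Measure vectors from the orthocenter and set R = circumradius, d = OI/R,
   U = I - O and V = 2 I - O - H. Then |U| = R d, |V| = R d^2 and
   U.V = R^2 d^3 t with -1 <= t <= 1, and every X_i - H is a combination
   of V and U whose coefficients are rational in d and d^3 t: the points O, G,
   N, I, Na, Sp have constant coefficients, the mittenpunkt is a multiple of Sp,
   the Gergonne point is 3 G - 2 M, and the symmedian point lies on the line IM.
   Each bound becomes a polynomial inequality on the rectangle
   0 <= d <= 1, -1 <= t <= 1, with nonnegative Bernstein coefficients.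
   For D(4,6) <= C3 D(4,7) the extremal triangle has t = -1, where the ratio is
   (6 + 7 d - d^3) / (6 + 4 d + 2 d^2). This boundary value dominates the ratio
   at (d, t) for d <= 1/2, while for d >= 1/2 the square of the ratio is at most
   39/32 < C3^2. *)
Require Import Defs.
From Stdlib Require Import Reals Lra Lia.

Open Scope R_scope.

(** * Side lengths and tangent lengths of a triangle *)

Lemma dist_sqr (P Q : point) :
  Defs.dist P Q ^ 2 = (fst P - fst Q) ^ 2 + (snd P - snd Q) ^ 2.
Proof.
  unfold Defs.dist, dist_euc. rewrite pow2_sqrt.
  - unfold Rsqr; ring.
  - apply Rplus_le_le_0_compat; apply Rle_0_sqr.
Qed.

Lemma dist_ge0 (P Q : point) : 0 <= Defs.dist P Q.
Proof. apply sqrt_pos. Qed.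

(** If the cross product vanishes, a common line is explicit: AB when A and B differ, AC when A = B,
    and a vertical line when A = B and C has the same first coordinate. *)
Lemma is_triangle_cross (A B C : point) :
  is_triangle A B C ->
  (fst B - fst A) * (snd C - snd A) - (fst C - fst A) * (snd B - snd A) <> 0.
Proof.
  intros tri cross0; apply tri; unfold collinear.
  destruct (Req_dec (fst B) (fst A)) as [h1 | h1];
    [destruct (Req_dec (snd B) (snd A)) as [h2 | h2]|].
  - destruct (Req_dec (fst C) (fst A)) as [h3 | h3].
    + exists 1, 0, (fst A); repeat split; lra.
    + exists (snd C - snd A), (fst A - fst C),
        ((snd C - snd A) * fst A + (fst A - fst C) * snd A).
      rewrite h1, h2; repeat split; lra.
  - exists (snd B - snd A), (fst A - fst B),
      ((snd B - snd A) * fst A + (fst A - fst B) * snd A).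
    repeat split; lra.
  - exists (snd B - snd A), (fst A - fst B),
      ((snd B - snd A) * fst A + (fst A - fst B) * snd A).
    repeat split; lra.
Qed.

(** The witnesses are the tangent lengths from the vertices to the incircle. Their positivity comes
    from Heron's formula, [k] being twice the signed area. *)
Lemma triangle_ravi (A B C : point) :
  is_triangle A B C ->
  exists x y z : R,
    (0 < x /\ 0 < y /\ 0 < z) /\
    Defs.dist B C = y + z /\ Defs.dist C A = z + x /\ Defs.dist A B = x + y.
Proof.
  intros tri; apply is_triangle_cross in tri.
  pose proof (dist_sqr B C) as ea; pose proof (dist_ge0 B C) as ha.
  pose proof (dist_sqr C A) as eb; pose proof (dist_ge0 C A) as hb.
  pose proof (dist_sqr A B) as ec; pose proof (dist_ge0 A B) as hc.
  set (a := Defs.dist B C) in *; set (b := Defs.dist C A) in *.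
  set (c := Defs.dist A B) in *.
  set (k := _ - _) in tri.
  assert (heron : (a + b + c) * ((b + c - a) * (c + a - b) * (a + b - c))
                  = 4 * k ^ 2).
  { transitivity (4 * b ^ 2 * c ^ 2 - (b ^ 2 + c ^ 2 - a ^ 2) ^ 2); [ring|].
    rewrite ea, eb, ec; unfold k; ring. }
  assert (k2 : 0 < k ^ 2) by (rewrite <- Rsqr_pow2; apply Rsqr_pos_lt; exact tri).
  assert (prod : 0 < (b + c - a) * (c + a - b) * (a + b - c)).
  { assert (0 <= a + b + c) by lra. nra. }
  exists ((b + c - a) / 2), ((c + a - b) / 2), ((a + b - c) / 2).
  (* Two of the three factors add up to twice a side. If u <= 0, then v and w are nonnegative and
     the product cannot be positive. *)
  assert (pos : forall u v w, 0 <= u + v -> 0 <= u + w ->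
            0 < u * v * w -> 0 < u).
  { intros u v w huv huw h; destruct (Rlt_le_dec 0 u) as [|hu]; [assumption|].
    assert (0 <= v * w) by (apply Rmult_le_pos; lra).
    nra. }
  repeat split; try lra.
  - enough (0 < b + c - a) by lra.
    apply (pos _ (c + a - b) (a + b - c)); lra.
  - enough (0 < c + a - b) by lra.
    apply (pos _ (b + c - a) (a + b - c)); lra.
  - enough (0 < a + b - c) by lra.
    apply (pos _ (b + c - a) (c + a - b)); lra.
Qed.

Ltac positivity := repeat first
  [ assumption | lra | apply Rplus_lt_0_compat | apply Rmult_lt_0_compat
  | apply pow_lt ].

Ltac nonnegativity := repeat first
  [ assumption | apply Rplus_le_le_0_compat | apply Rmult_le_pos | apply pow_le
  | lra ].

(** * Linear relations between the centers *)

(* One coordinate of the center, as a function of the corresponding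
   coordinates p, q, r of the vertices; the sides are y + z, z + x, x + y. *)
Definition center (n : nat) (x y z p q r : R) : R :=
  let u := Defs.f n (y + z) (z + x) (x + y) in
  let v := Defs.f n (z + x) (x + y) (y + z) in
  let w := Defs.f n (x + y) (y + z) (z + x) in
  (u * p + v * q + w * r) / (u + v + w).

Lemma incenterE (x y z p q r : R) :
  0 < x -> 0 < y -> 0 < z ->
  let ctr n := center n x y z p q r in
  ctr 1%nat = ((y + z) * p + (z + x) * q + (x + y) * r) / (2 * (x + y + z)).
Proof.
  intros hx hy hz ctr; unfold ctr, center, Defs.f.
  field. lra.
Qed.

(** Here x y z (x + y + z) is the squared area, and x (x + y + z) - y z is (b^2 + c^2 - a^2) / 2. *)
Lemma circumcenterE (x y z p q r : R) :
  0 < x -> 0 < y -> 0 < z ->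
  let ctr n := center n x y z p q r in
  ctr 3%nat = ((y + z) ^ 2 * (x * (x + y + z) - y * z) * p
           + (z + x) ^ 2 * (y * (x + y + z) - z * x) * q
           + (x + y) ^ 2 * (z * (x + y + z) - x * y) * r)
          / (8 * (x * y * z * (x + y + z))).
Proof.
  intros hx hy hz ctr; unfold ctr.
  assert (0 < x * y * z * (x + y + z)) by positivity.
  unfold center, Defs.f.
  (* Factoring the sum of the weights leaves [field] with side conditions that are visibly true. *)
  replace ((y + z) ^ 2 * ((y + z) ^ 2 - (z + x) ^ 2 - (x + y) ^ 2) +
   (z + x) ^ 2 * ((z + x) ^ 2 - (x + y) ^ 2 - (y + z) ^ 2) +
   (x + y) ^ 2 * ((x + y) ^ 2 - (y + z) ^ 2 - (z + x) ^ 2))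
   with (-16 * (x * y * z * (x + y + z))) by ring.
  field. repeat split; lra.
Qed.

Lemma orthocenterE (x y z p q r : R) :
  0 < x -> 0 < y -> 0 < z ->
  let ctr n := center n x y z p q r in
  ctr 4%nat = ((y * (x + y + z) - z * x) * (z * (x + y + z) - x * y) * p
           + (z * (x + y + z) - x * y) * (x * (x + y + z) - y * z) * q
           + (x * (x + y + z) - y * z) * (y * (x + y + z) - z * x) * r)
          / (4 * (x * y * z * (x + y + z))).
Proof.
  intros hx hy hz ctr; unfold ctr.
  assert (0 < x * y * z * (x + y + z)) by positivity.
  unfold center, Defs.f.
  match goal with |- _ / ?d = _ =>
   replace d with (16 * (x * y * z * (x + y + z))) by ring end.
  field. repeat split; lra.
Qed.

Lemma centroidE (x y z p q r : R) :
  0 < x -> 0 < y -> 0 < z ->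
  let ctr n := center n x y z p q r in
  ctr 2%nat = (2 * ctr 3%nat + ctr 4%nat) / 3.
Proof.
  intros hx hy hz ctr; unfold ctr.
  rewrite circumcenterE, orthocenterE by assumption; unfold center, Defs.f.
  field. repeat split; lra.
Qed.

Lemma nine_pointE (x y z p q r : R) :
  0 < x -> 0 < y -> 0 < z ->
  let ctr n := center n x y z p q r in
  ctr 5%nat = (ctr 3%nat + ctr 4%nat) / 2.
Proof.
  intros hx hy hz ctr; unfold ctr.
  rewrite circumcenterE, orthocenterE by assumption; unfold center, Defs.f.
  assert (0 < x * y * z * (x + y + z)) by positivity.
  match goal with |- _ / ?d = _ =>
   replace d with (-32 * (x * y * z * (x + y + z))) by ring end.
  field. repeat split; lra.
Qed.

Lemma nagelE (x y z p q r : R) :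
  0 < x -> 0 < y -> 0 < z ->
  let ctr n := center n x y z p q r in
  ctr 8%nat = 3 * ctr 2%nat - 2 * ctr 1%nat.
Proof.
  intros hx hy hz ctr; unfold ctr, center, Defs.f.
  field. repeat split; lra.
Qed.

Lemma spiekerE (x y z p q r : R) :
  0 < x -> 0 < y -> 0 < z ->
  let ctr n := center n x y z p q r in
  ctr 10%nat = (3 * ctr 2%nat - ctr 1%nat) / 2.
Proof.
  intros hx hy hz ctr; unfold ctr, center, Defs.f.
  field. repeat split; lra.
Qed.

Lemma mittenpunktE (x y z p q r : R) :
  0 < x -> 0 < y -> 0 < z ->
  let ctr n := center n x y z p q r in
  let s := (x + y + z) * (x * y + y * z + z * x) in
  s * ctr 9%nat = (s + x * y * z) * ctr 10%nat - x * y * z * ctr 4%nat.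
Proof.
  intros hx hy hz ctr s; unfold ctr.
  rewrite orthocenterE by assumption; unfold s, center, Defs.f.
  assert (0 < x * y + y * z + z * x) by positivity.
  match goal with |- _ * (_ / ?d) = _ =>
   replace d with (-4 * (x * y + y * z + z * x)) by ring end.
  field. repeat split; lra.
Qed.

Lemma gergonneE (x y z p q r : R) :
  0 < x -> 0 < y -> 0 < z ->
  let ctr n := center n x y z p q r in
  ctr 7%nat = 3 * ctr 2%nat - 2 * ctr 9%nat.
Proof.
  intros hx hy hz ctr; unfold ctr, center, Defs.f.
  assert (0 < x * y + y * z + z * x) by positivity.
  match goal with |- _ / ?d = _ - _ * (_ / ?e) =>
   replace d with (4 * (x * y + y * z + z * x)) by ring;
   replace e with (-4 * (x * y + y * z + z * x)) by ring end.
  field. repeat split; lra.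
Qed.

Lemma symmedianE (x y z p q r : R) :
  0 < x -> 0 < y -> 0 < z ->
  let ctr n := center n x y z p q r in
  let s := x * y + y * z + z * x in
  ((x + y + z) ^ 2 - s) * ctr 6%nat = (x + y + z) ^ 2 * ctr 1%nat - s * ctr 9%nat.
Proof.
  intros hx hy hz ctr s; unfold ctr, s, center, Defs.f.
  assert (0 < x * y + y * z + z * x) by positivity.
  assert (0 < (y + z) ^ 2 + (z + x) ^ 2 + (x + y) ^ 2) by positivity.
  match goal with |- _ = _ - _ * (_ / ?e) =>
   replace e with (-4 * (x * y + y * z + z * x)) by ring end.
  field. repeat split; lra.
Qed.
(** * The metric data of a triangle *)

(** The square of R = abc / (4 area). *)
Definition circumradius_sqr (x y z : R) : R :=
  ((y + z) * (z + x) * (x + y)) ^ 2 / (16 * (x * y * z * (x + y + z))).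

(* OI^2 / R^2 = 1 - 2 r / R *)
Definition euler_ratio (x y z : R) : R :=
  1 - 8 * (x * y * z) / ((y + z) * (z + x) * (x + y)).

(* The value of U.V / R^2, solved from
   s^2 / R^2 = 2 + 10 r / R - (r / R)^2 + 2 U.V / R^2. *)
Definition blundon_ratio (x y z : R) : R :=
  let n := euler_ratio x y z in
  ((x + y + z) ^ 2 / circumradius_sqr x y z - 2 - 5 * (1 - n)
   + (1 - n) ^ 2 / 4) / 2.

Lemma circumradius_sqr_gt0 (x y z : R) :
  0 < x -> 0 < y -> 0 < z -> 0 < circumradius_sqr x y z.
Proof.
  intros hx hy hz; apply Rdiv_lt_0_compat; positivity.
Qed.

Lemma euler_ratio_lt1 (x y z : R) :
  0 < x -> 0 < y -> 0 < z -> euler_ratio x y z < 1.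
Proof.
  intros hx hy hz; unfold euler_ratio.
  enough (0 < 8 * (x * y * z) / ((y + z) * (z + x) * (x + y))) by lra.
  apply Rdiv_lt_0_compat; positivity.
Qed.

(* The left-hand side is 4 R r + r^2. *)
Lemma pair_sum_circumradius (x y z : R) :
  0 < x -> 0 < y -> 0 < z ->
  let n := euler_ratio x y z in
  circumradius_sqr x y z * ((1 - n) * (9 - n) / 4) = x * y + y * z + z * x.
Proof.
  intros hx hy hz n; unfold n, circumradius_sqr, euler_ratio.
  field; repeat split; lra.
Qed.

(** The right-hand side is (a^2 + b^2 + c^2) / 2, the coefficient of X_6 in [symmedianE]; the
    bracket on the left becomes [denom 6]. *)
Lemma semiperimeter_circumradius (x y z : R) :
  0 < x -> 0 < y -> 0 < z ->
  let n := euler_ratio x y z in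
  circumradius_sqr x y z * (9 - 4 * n - n ^ 2 + 4 * blundon_ratio x y z) / 2 =
  (x + y + z) ^ 2 - (x * y + y * z + z * x).
Proof.
  intros hx hy hz n; unfold n, blundon_ratio, circumradius_sqr, euler_ratio.
  field; repeat split; lra.
Qed.

(* The inner product of two vectors given by barycentric weights of sum 0. *)
Definition bary_inner (x y z u1 u2 u3 v1 v2 v3 : R) : R :=
  - ((u2 * v3 + u3 * v2) * (y + z) ^ 2 + (u3 * v1 + u1 * v3) * (z + x) ^ 2
     + (u1 * v2 + u2 * v1) * (x + y) ^ 2) / 2.

Lemma bary_innerE (A B C : point) (x y z u1 u2 u3 v1 v2 v3 : R) :
  Defs.dist B C = y + z -> Defs.dist C A = z + x -> Defs.dist A B = x + y ->
  u1 + u2 + u3 = 0 -> v1 + v2 + v3 = 0 ->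
  (u1 * fst A + u2 * fst B + u3 * fst C) * (v1 * fst A + v2 * fst B + v3 * fst C)
  + (u1 * snd A + u2 * snd B + u3 * snd C) * (v1 * snd A + v2 * snd B + v3 * snd C)
  = bary_inner x y z u1 u2 u3 v1 v2 v3.
Proof.
  intros ea eb ec hu hv; unfold bary_inner.
  rewrite <- ea, <- eb, <- ec, !dist_sqr.
  replace u1 with (- u2 - u3) by lra; replace v1 with (- v2 - v3) by lra.
  field.
Qed.

(* The weight of the first vertex in U and in V; the other two weights are
   obtained by exchanging variables. *)
Definition weightU (x y z : R) : R :=
  (y + z) / (2 * (x + y + z))
  - (y + z) ^ 2 * (x * (x + y + z) - y * z) / (8 * (x * y * z * (x + y + z))).

Definition weightV (x y z : R) : R :=
  (y + z) / (x + y + z)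
  - (y + z) ^ 2 * (x * (x + y + z) - y * z) / (8 * (x * y * z * (x + y + z)))
  - (y * (x + y + z) - z * x) * (z * (x + y + z) - x * y)
    / (4 * (x * y * z * (x + y + z))).

Lemma weightU_sum (x y z : R) :
  0 < x -> 0 < y -> 0 < z ->
  weightU x y z + weightU y z x + weightU z x y = 0.
Proof. intros hx hy hz; unfold weightU; field; repeat split; lra. Qed.

Lemma weightV_sum (x y z : R) :
  0 < x -> 0 < y -> 0 < z ->
  weightV x y z + weightV y z x + weightV z x y = 0.
Proof. intros hx hy hz; unfold weightV; field; repeat split; lra. Qed.

Lemma weightUE (x y z p q r : R) :
  0 < x -> 0 < y -> 0 < z ->
  center 1 x y z p q r - center 3 x y z p q r =
  weightU x y z * p + weightU y z x * q + weightU z x y * r.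
Proof.
  intros hx hy hz; rewrite incenterE, circumcenterE by assumption.
  unfold weightU; field; repeat split; lra.
Qed.

Lemma weightVE (x y z p q r : R) :
  0 < x -> 0 < y -> 0 < z ->
  2 * center 1 x y z p q r - center 3 x y z p q r - center 4 x y z p q r =
  weightV x y z * p + weightV y z x * q + weightV z x y * r.
Proof.
  intros hx hy hz; rewrite incenterE, circumcenterE, orthocenterE by assumption.
  unfold weightV; field; repeat split; lra.
Qed.

(** Euler's formula OI^2 = R^2 - 2 R r. *)
Lemma inner_UU (x y z : R) :
  0 < x -> 0 < y -> 0 < z ->
  bary_inner x y z (weightU x y z) (weightU y z x) (weightU z x y)
    (weightU x y z) (weightU y z x) (weightU z x y) =
  circumradius_sqr x y z * euler_ratio x y z.
Proof.
  intros hx hy hz; unfold bary_inner, weightU, circumradius_sqr, euler_ratio.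
  field; repeat split; lra.
Qed.

(** V is twice the vector from the nine-point center to I, so this is Feuerbach's relation NI = R /
    2 - r. *)
Lemma inner_VV (x y z : R) :
  0 < x -> 0 < y -> 0 < z ->
  bary_inner x y z (weightV x y z) (weightV y z x) (weightV z x y)
    (weightV x y z) (weightV y z x) (weightV z x y) =
  circumradius_sqr x y z * euler_ratio x y z ^ 2.
Proof.
  intros hx hy hz; unfold bary_inner, weightV, circumradius_sqr, euler_ratio.
  field; repeat split; lra.
Qed.

Lemma inner_UV (x y z : R) :
  0 < x -> 0 < y -> 0 < z ->
  bary_inner x y z (weightU x y z) (weightU y z x) (weightU z x y)
    (weightV x y z) (weightV y z x) (weightV z x y) =
  circumradius_sqr x y z * blundon_ratio x y z.
Proof.
  intros hx hy hz; unfold bary_inner, weightU, weightV, blundon_ratio,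
    circumradius_sqr, euler_ratio.
  field; repeat split; lra.
Qed.

(** * The centers in the frame V, U *)

(* X_i - H = (coefV V + coefU U) / denom. The polynomials are homogenized by h
   in degree with respect to d and by e with respect to t, so that a
   substitution of Bernstein coordinates turns them into forms; the geometric
   values are those at h = e = 1. *)
Definition denom (i : nat) (d t h e : R) : R :=
  match i with
  | 2%nat => 3
  | 5%nat | 10%nat => 2
  | 6%nat => (9 * h ^ 4 - 4 * d ^ 2 * h ^ 2 - d ^ 4) * e + 4 * d ^ 3 * t * h
  | 7%nat | 9%nat => 9 * h ^ 2 - d ^ 2
  | _ => 1
  end.

Definition coefV (i : nat) (d t h e : R) : R :=
  match i with
  | 2%nat => 2
  | 4%nat | 8%nat => 0
  | 6%nat => (11 * h ^ 4 - 6 * d ^ 2 * h ^ 2 - d ^ 4) * e + 4 * d ^ 3 * t * h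
  | 7%nat => 8 * h ^ 2
  | 9%nat => 5 * h ^ 2 - d ^ 2
  | _ => 1
  end.

Definition coefU (i : nat) (d t h e : R) : R :=
  match i with
  | 1%nat => -1
  | 2%nat => -4
  | 4%nat => 0
  | 6%nat => - ((6 * h ^ 4 - 2 * d ^ 4) * e + 4 * d ^ 3 * t * h)
  | 7%nat => - (6 * h ^ 2 + 2 * d ^ 2)
  | 9%nat => -3 * (5 * h ^ 2 - d ^ 2)
  | 10%nat => -3
  | _ => -2
  end.

(* The squared length of (coefV V + coefU U) / OI. *)
Definition sqnorm (i : nat) (d t h e : R) : R :=
  let v := coefV i d t h e in
  let u := coefU i d t h e in
  (v ^ 2 * d ^ 2 + u ^ 2 * h ^ 2) * e + 2 * v * u * d * t * h.

(** Up to the factor R^2 / 2, this denominator is half the sum of the squared sides. *)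
Lemma denom6_gt0 (x y z d t : R) :
  0 < x -> 0 < y -> 0 < z ->
  d ^ 2 = euler_ratio x y z -> d ^ 3 * t = blundon_ratio x y z ->
  0 < denom 6 d t 1 1.
Proof.
  intros hx hy hz hd ht.
  pose proof (semiperimeter_circumradius x y z hx hy hz) as h.
  pose proof (circumradius_sqr_gt0 x y z hx hy hz) as hR.
  cbv zeta in h; rewrite <- hd, <- ht in h.
  replace (9 - 4 * d ^ 2 - (d ^ 2) ^ 2 + 4 * (d ^ 3 * t))
    with (denom 6 d t 1 1) in h by (unfold denom; ring).
  assert (0 < (x + y + z) ^ 2 - (x * y + y * z + z * x)).
  { replace (_ - _) with (x ^ 2 + y ^ 2 + z ^ 2 + x * y + y * z + z * x) by ring.
    positivity. }
  apply (Rmult_lt_reg_l (circumradius_sqr x y z)); lra.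
Qed.

Lemma denom_gt0 (i : nat) (d t : R) :
  0 <= d < 1 -> 0 < denom 6 d t 1 1 -> 0 < denom i d t 1 1.
Proof.
  intros hd h6.
  assert (d ^ 2 < 9) by nra.
  do 10 (destruct i as [|i]; [first [exact h6 | unfold denom; lra]|]).
  destruct i; unfold denom; lra.
Qed.

Lemma center_coef (i : nat) (x y z p q r d t : R) :
  0 < x -> 0 < y -> 0 < z ->
  d ^ 2 = euler_ratio x y z -> d ^ 3 * t = blundon_ratio x y z ->
  (1 <= i <= 10)%nat ->
  let ctr n := center n x y z p q r in
  denom i d t 1 1 * (ctr i - ctr 4%nat) =
  coefV i d t 1 1 * (2 * ctr 1%nat - ctr 3%nat - ctr 4%nat)
  + coefU i d t 1 1 * (ctr 1%nat - ctr 3%nat).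
Proof.
  intros hx hy hz hd ht hi ctr.
  pose proof (centroidE x y z p q r hx hy hz) as e2.
  pose proof (nine_pointE x y z p q r hx hy hz) as e5.
  pose proof (symmedianE x y z p q r hx hy hz) as e6.
  pose proof (gergonneE x y z p q r hx hy hz) as e7.
  pose proof (nagelE x y z p q r hx hy hz) as e8.
  pose proof (mittenpunktE x y z p q r hx hy hz) as e9.
  pose proof (spiekerE x y z p q r hx hy hz) as e10.
  cbv zeta in e2, e5, e6, e7, e8, e9, e10; unfold ctr; clear ctr.
  set (c1 := center 1 x y z p q r) in *; set (c2 := center 2 x y z p q r) in *.
  set (c3 := center 3 x y z p q r) in *; set (c4 := center 4 x y z p q r) in *.
  set (c5 := center 5 x y z p q r) in *; set (c6 := center 6 x y z p q r) in *.
  set (c7 := center 7 x y z p q r) in *; set (c8 := center 8 x y z p q r) in *.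
  set (c9 := center 9 x y z p q r) in *; set (c10 := center 10 x y z p q r) in *.
  (* As (y + z)(z + x)(x + y) = s - xyz, the factor 1 + xyz / s of [mittenpunktE] equals (10 - 2
     d^2) / (9 - d^2). *)
  assert (m9 : (9 - d ^ 2) * (c9 - c4) = (10 - 2 * d ^ 2) * (c10 - c4)).
  { set (s := (x + y + z) * (x * y + y * z + z * x)) in *.
    assert (0 < s) by (unfold s; positivity).
    replace (c9 - c4) with ((s * c9 - s * c4) / s) by (field; lra).
    rewrite e9, hd; unfold s, euler_ratio; field; repeat split; nra. }
  (* This is [symmedianE] recentered at I, with both coefficients divided by R^2 / 2. *)
  assert (m6 : (9 - 4 * d ^ 2 - d ^ 4 + 4 * d ^ 3 * t) * (c6 - c1)
               = - ((1 - d ^ 2) * (9 - d ^ 2) / 2) * (c9 - c1)).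
  { pose proof (circumradius_sqr_gt0 x y z hx hy hz) as hR.
    pose proof (pair_sum_circumradius x y z hx hy hz) as i1.
    pose proof (semiperimeter_circumradius x y z hx hy hz) as i2.
    cbv zeta in i1, i2; rewrite <- hd in i1, i2; rewrite <- ht in i2.
    apply (Rmult_eq_reg_l (circumradius_sqr x y z)); [|lra].
    transitivity (2 * (((x + y + z) ^ 2 - (x * y + y * z + z * x)) * c6
                       - ((x + y + z) ^ 2 - (x * y + y * z + z * x)) * c1)).
    - rewrite <- i2; field.
    - rewrite e6.
      transitivity (-2 * (x * y + y * z + z * x) * (c9 - c1)); [ring|].
      rewrite <- i1; field. }
  assert (cases : i = 1%nat \/ i = 2%nat \/ i = 3%nat \/ i = 4%nat \/ i = 5%nat
            \/ i = 6%nat \/ i = 7%nat \/ i = 8%nat \/ i = 9%nat \/ i = 10%nat)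
    by lia.
  repeat destruct cases as [-> | cases]; try subst i;
    unfold denom, coefV, coefU;
    fold c2 c5 c6 c7 c8 c9 c10; fold c1 c3; fold c4;
    clearbody c1 c2 c3 c4 c5 c6 c7 c8 c9 c10.
  - ring.
  - rewrite e2; field.
  - ring.
  - ring.
  - rewrite e5; field.
  - replace (_ * (c6 - c4)) with
      ((9 - 4 * d ^ 2 - d ^ 4 + 4 * d ^ 3 * t) * (c6 - c1)
       + (9 - 4 * d ^ 2 - d ^ 4 + 4 * d ^ 3 * t) * (c1 - c4)) by ring.
    rewrite m6.
    replace (- ((1 - d ^ 2) * (9 - d ^ 2) / 2) * (c9 - c1)) with
      (- ((1 - d ^ 2) / 2) * ((9 - d ^ 2) * (c9 - c4) - (9 - d ^ 2) * (c1 - c4)))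
      by field.
    rewrite m9, e10, e2; field.
  - replace (_ * (c7 - c4)) with
      (3 * (9 - d ^ 2) * (c2 - c4) - 2 * ((9 - d ^ 2) * (c9 - c4)))
      by (rewrite e7; ring).
    rewrite m9, e10, e2; field.
  - rewrite e8, e2; field.
  - replace (_ * (c9 - c4)) with ((9 - d ^ 2) * (c9 - c4)) by ring.
    rewrite m9, e10, e2; field.
  - rewrite e10, e2; field.
Qed.

(** * Distances from the orthocenter in terms of E, d and t *)

Lemma X_center (A B C : point) (x y z : R) (i : nat) :
  Defs.dist B C = y + z -> Defs.dist C A = z + x -> Defs.dist A B = x + y ->
  X A B C i = (center i x y z (fst A) (fst B) (fst C),
               center i x y z (snd A) (snd B) (snd C)).
Proof. intros ea eb ec; unfold X; rewrite ea, eb, ec; reflexivity. Qed.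

Lemma center_distances (A B C : point) :
  is_triangle A B C ->
  exists E d t : R,
    0 <= E /\ 0 <= d <= 1 /\ -1 <= t <= 1 /\
    forall i, (1 <= i <= 10)%nat ->
      0 < denom i d t 1 1 /\
      denom i d t 1 1 ^ 2 * D A B C 4 i ^ 2 = E * sqnorm i d t 1 1.
Proof.
  intros tri.
  destruct (triangle_ravi A B C tri) as (x & y & z & (hx & hy & hz) & ea & eb & ec).
  pose proof (weightU_sum x y z hx hy hz) as sU.
  pose proof (weightV_sum x y z hx hy hz) as sV.
  pose proof (bary_innerE A B C x y z _ _ _ _ _ _ ea eb ec sU sU) as UU.
  pose proof (bary_innerE A B C x y z _ _ _ _ _ _ ea eb ec sV sV) as VV.
  pose proof (bary_innerE A B C x y z _ _ _ _ _ _ ea eb ec sU sV) as UV.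
  rewrite inner_UU in UU by assumption; rewrite inner_VV in VV by assumption.
  rewrite inner_UV in UV by assumption.
  rewrite <- !weightUE in UU, UV by assumption.
  rewrite <- !weightVE in VV, UV by assumption.
  set (U1 := center 1 x y z (fst A) (fst B) (fst C) - _) in UU, UV.
  set (U2 := center 1 x y z (snd A) (snd B) (snd C) - _) in UU, UV.
  set (V1 := 2 * center 1 x y z (fst A) (fst B) (fst C) - _ - _) in VV, UV.
  set (V2 := 2 * center 1 x y z (snd A) (snd B) (snd C) - _ - _) in VV, UV.
  pose proof (circumradius_sqr_gt0 x y z hx hy hz) as hR.
  pose proof (euler_ratio_lt1 x y z hx hy hz) as hn1.
  set (R2 := circumradius_sqr x y z) in *.
  set (n := euler_ratio x y z) in *; set (m := blundon_ratio x y z) in *.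
  assert (hn0 : 0 <= n).
  { apply (Rmult_le_reg_l R2); [assumption|]; nra. }
  (* Cauchy-Schwarz for U and V, through Lagrange's identity. *)
  assert (cs : m ^ 2 <= n ^ 3).
  { apply (Rmult_le_reg_l (R2 ^ 2)); [positivity|].
    replace (R2 ^ 2 * m ^ 2) with ((R2 * m) ^ 2) by ring.
    replace (R2 ^ 2 * n ^ 3) with ((R2 * n) * (R2 * n ^ 2)) by ring.
    rewrite <- UU, <- VV, <- UV.
    pose proof (pow2_ge_0 (U1 * V2 - U2 * V1)); nra. }
  set (d := sqrt n).
  assert (hd2 : d ^ 2 = n) by (apply pow2_sqrt; assumption).
  assert (hd : 0 <= d < 1).
  { split; [apply sqrt_pos|]. pose proof (sqrt_pos n); fold d in H; nra. }
  (* t is the cosine of the angle between U and V; if d = 0 both vectors vanish and t = 0 is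
     chosen. *)
  assert (exists t, -1 <= t <= 1 /\ d ^ 3 * t = m) as (t & ht & hm).
  { rewrite <- hd2 in cs.
    replace ((d ^ 2) ^ 3) with ((d ^ 3) ^ 2) in cs by ring.
    destruct (Req_dec d 0) as [d0 | d0].
    - exists 0; rewrite d0 in *; split; [lra|]; nra.
    - assert (d3 : 0 < d ^ 3) by (apply pow_lt; lra).
      assert (hm : - d ^ 3 <= m <= d ^ 3).
      { rewrite <- !Rsqr_pow2 in cs.
        split; [apply Rsqr_neg_pos_le_0 | apply Rsqr_incr_0_var]; lra. }
      exists (m / d ^ 3); split; [|field; lra].
      split; apply (Rmult_le_reg_r (d ^ 3)); try assumption;
        unfold Rdiv; rewrite ?Rmult_assoc, ?Rinv_l; lra. }
  pose proof (denom6_gt0 x y z d t hx hy hz hd2 hm) as h6.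
  (* The common scale E is OI^2, possibly zero. *)
  exists (R2 * n), d, t.
  split; [nra|]; split; [lra|]; split; [assumption|].
  intros i hi; split; [apply denom_gt0; assumption|].
  pose proof (center_coef i x y z (fst A) (fst B) (fst C) d t hx hy hz hd2 hm hi)
    as k1.
  pose proof (center_coef i x y z (snd A) (snd B) (snd C) d t hx hy hz hd2 hm hi)
    as k2.
  cbv beta zeta in k1, k2; fold U1 V1 in k1; fold U2 V2 in k2.
  unfold D; rewrite dist_sqr, !(X_center A B C x y z) by assumption; cbn [fst snd].
  set (v := coefV i d t 1 1) in *; set (u := coefU i d t 1 1) in *.
  transitivity ((v * V1 + u * U1) ^ 2 + (v * V2 + u * U2) ^ 2).
  { rewrite <- k1, <- k2; ring. }
  transitivity (v ^ 2 * (V1 * V1 + V2 * V2) + u ^ 2 * (U1 * U1 + U2 * U2)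
                + 2 * v * u * (U1 * V1 + U2 * V2)); [ring|].
  rewrite UU, VV, UV, <- hm, <- hd2; unfold sqnorm; fold v u; ring.
Qed.

(** * Polynomial inequalities on the rectangle *)

(* The endpoints a/a' and b/b' are kept as fractions so that ring_simplify
   only meets integer coefficients. *)
Lemma rectangle_ge0 (F : R -> R -> R -> R -> R) (a a' b b' d t : R) :
  (forall s s' k k', 0 <= s -> 0 <= s' -> 0 <= k -> 0 <= k' ->
     0 <= F (a * s' + b * s) (k - k') (a' * s' + b' * s) (k + k')) ->
  a * b' < b * a' -> a <= d * a' -> d * b' <= b -> -1 <= t <= 1 ->
  0 <= F d t 1 1.
Proof.
  (* The values below solve a s' + b s = d, a' s' + b' s = 1, k - k' = t and k + k' = 1, and they
     are nonnegative on the rectangle. *)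
  intros F_ge0 hab had hdb ht.
  set (s := (d * a' - a) / (b * a' - a * b')).
  set (s' := (b - d * b') / (b * a' - a * b')).
  set (k := (1 + t) / 2); set (k' := (1 - t) / 2).
  replace (F d t 1 1) with (F (a * s' + b * s) (k - k') (a' * s' + b' * s) (k + k')).
  - apply F_ge0; unfold s, s', k, k'; try lra; apply Rle_mult_inv_pos; lra.
  - f_equal; unfold s, s', k, k'; field; lra.
Qed.

(** After the substitution, the expanded form has only nonnegative coefficients, so it is bounded
    term by term. *)
Ltac bernstein a a' b b' F :=
  apply (rectangle_ge0 F a a' b b'); [|lra|lra|lra|assumption];
  intros; unfold sqnorm, denom, coefV, coefU; ring_simplify; nonnegativity.

(** * The comparison of D(4,6) with D(4,7) *)

Lemma sqnorm_le_67_small (d t : R) :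
  0 <= d <= 1 / 2 -> -1 <= t <= 1 ->
  (6 + 4 * d + 2 * d ^ 2) ^ 2 * (denom 7 d t 1 1 ^ 2 * sqnorm 6 d t 1 1) <=
  (6 + 7 * d - d ^ 3) ^ 2 * (denom 6 d t 1 1 ^ 2 * sqnorm 7 d t 1 1).
Proof.
  intros hd ht; apply Rge_le, Rminus_ge, Rle_ge.
  (* Powers of 1 mark the places of h; the extra factor 1 raises the quadratic to degree 3, matching
     the cubic. *)
  replace (6 + 4 * d + 2 * d ^ 2)
    with (1 * (6 * 1 ^ 2 + 4 * d * 1 + 2 * d ^ 2)) by ring.
  replace (6 + 7 * d - d ^ 3) with (6 * 1 ^ 3 + 7 * d * 1 ^ 2 - d ^ 3) by ring.
  bernstein 0 1 1 2 (fun d t h e =>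
    (6 * h ^ 3 + 7 * d * h ^ 2 - d ^ 3) ^ 2
    * (denom 6 d t h e ^ 2 * sqnorm 7 d t h e)
    - (h * (6 * h ^ 2 + 4 * d * h + 2 * d ^ 2)) ^ 2
      * (denom 7 d t h e ^ 2 * sqnorm 6 d t h e)).
Qed.

Lemma sqnorm_le_67_large (d t : R) :
  1 / 2 <= d <= 1 -> -1 <= t <= 1 ->
  32 * (denom 7 d t 1 1 ^ 2 * sqnorm 6 d t 1 1) <=
  39 * (denom 6 d t 1 1 ^ 2 * sqnorm 7 d t 1 1).
Proof.
  intros hd ht; apply Rge_le, Rminus_ge, Rle_ge.
  bernstein 1 2 1 1 (fun d t h e =>
    39 * (denom 6 d t h e ^ 2 * sqnorm 7 d t h e)
    - 32 * (denom 7 d t h e ^ 2 * sqnorm 6 d t h e)).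
Qed.

(* On d >= 0 the quotient (6 + 7 d - d^3) / (6 + 4 d + 2 d^2) is maximal at the
   positive root d0 of d^4 + 4 d^3 + 16 d^2 + 12 d - 9; its derivative vanishes
   there, so the maximum C3 is the quotient of the derivatives. *)
Lemma C3_spec :
  exists C3 : R,
    unique is_positive_root C3 /\
    Rabs (C3 - 1104068697 / 10 ^ 9) < 5 / 10 ^ 10 /\
    forall d, 0 <= d -> 6 + 7 * d - d ^ 3 <= C3 * (6 + 4 * d + 2 * d ^ 2).
Proof.
  set (g := fun d => d ^ 4 + 4 * d ^ 3 + 16 * d ^ 2 + 12 * d - 9).
  assert (g_cont : continuity g).
  { apply derivable_continuous; unfold g; reg. }
  (* The bracket around d0 is narrow enough to give the required decimals of C3. *)
  destruct (IVT g (4484393873 / 10 ^ 10) (4484393874 / 10 ^ 10) g_cont)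
    as (d0 & hd0 & root0); try (unfold g; lra).
  unfold g in root0; clear g g_cont.
  set (C3 := (7 - 3 * d0 ^ 2) / (4 + 4 * d0)).
  assert (mulC : C3 * (4 + 4 * d0) = 7 - 3 * d0 ^ 2) by (unfold C3; field; lra).
  assert (approx : 11040686966 / 10 ^ 10 < C3 < 11040686973 / 10 ^ 10).
  { split; apply (Rmult_lt_reg_r (4 + 4 * d0)); try lra; rewrite mulC; nra. }
  assert (rootC : is_positive_root C3).
  { split; [lra|].
    (* With the denominator cleared, the quartic at C3 is divisible by the quartic that defines
       d0. *)
    replace (8 * C3 ^ 4 - _ + _ - _ - _) with
      ((d0 ^ 4 + 4 * d0 ^ 3 + 16 * d0 ^ 2 + 12 * d0 - 9)
       * (648 * d0 ^ 4 + 1296 * d0 ^ 3 - 1440 * d0 ^ 2 - 4176 * d0 - 2344)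
       / (4 + 4 * d0) ^ 4) by (unfold C3; field; lra).
    rewrite root0; field; lra. }
  exists C3; split; [split; [assumption|]|split].
  - intros y [y_gt0 rooty]; destruct rootC as [C_gt0 rootC].
    (* P(x)/x is increasing on x > 0 for the quartic P. *)
    assert (h : (y - C3) * (25 + C3 * y * (8 * (C3 ^ 2 + C3 * y + y ^ 2)
                             - 36 * (C3 + y) + 113)) = 0).
    { transitivity (C3 * (8 * y ^ 4 - 36 * y ^ 3 + 113 * y ^ 2 - 69 * y - 25)
        - y * (8 * C3 ^ 4 - 36 * C3 ^ 3 + 113 * C3 ^ 2 - 69 * C3 - 25)); [ring|].
      rewrite rootC, rooty; ring. }
    apply Rmult_integral in h; destruct h as [h | h]; [lra|].
    assert (0 < C3 * y) by (apply Rmult_lt_0_compat; assumption).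
    (* This equals 2 (C3 - y)^2 + 6 (C3 + y - 3)^2 + 59. *)
    assert (0 < 8 * (C3 ^ 2 + C3 * y + y ^ 2) - 36 * (C3 + y) + 113).
    { pose proof (pow2_ge_0 (C3 - y)); pose proof (pow2_ge_0 (C3 + y - 3)); nra. }
    nra.
  - apply Rabs_def1; lra.
  - intros d hd.
    (* At the maximum the difference has a double root; the d^2 coefficient fixes the remaining
       linear factor. *)
    assert (h : C3 * (6 + 4 * d + 2 * d ^ 2) - (6 + 7 * d - d ^ 3)
                = (d - d0) ^ 2 * (d + 2 * C3 + 2 * d0)).
    { apply (Rmult_eq_reg_r (4 + 4 * d0)); [|lra].
      apply Rminus_diag_uniq.
      transitivity (- 2 * (d0 ^ 4 + 4 * d0 ^ 3 + 16 * d0 ^ 2 + 12 * d0 - 9)).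
      - unfold C3; field; lra.
      - rewrite root0; ring. }
    assert (0 <= (d - d0) ^ 2 * (d + 2 * C3 + 2 * d0)).
    { apply Rmult_le_pos; [apply pow2_ge_0 | lra]. }
    lra.
Qed.

Lemma sqnorm_le_67 (C d t : R) :
  11040686 / 10 ^ 7 <= C ->
  6 + 7 * d - d ^ 3 <= C * (6 + 4 * d + 2 * d ^ 2) ->
  0 <= d <= 1 -> -1 <= t <= 1 -> 0 <= sqnorm 7 d t 1 1 ->
  denom 7 d t 1 1 ^ 2 * sqnorm 6 d t 1 1 <=
  C ^ 2 * (denom 6 d t 1 1 ^ 2 * sqnorm 7 d t 1 1).
Proof.
  intros hC max_d hd ht h7.
  assert (hr : 0 <= denom 6 d t 1 1 ^ 2 * sqnorm 7 d t 1 1).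
  { apply Rmult_le_pos; [apply pow2_ge_0 | assumption]. }
  set (l := denom 7 d t 1 1 ^ 2 * _); set (r := denom 6 d t 1 1 ^ 2 * _) in *.
  destruct (Rle_lt_dec d (1 / 2)) as [hd2 | hd2].
  - assert (h := sqnorm_le_67_small d t (conj (proj1 hd) hd2) ht); fold l r in h.
    assert (0 < 6 + 4 * d + 2 * d ^ 2) by nra.
    apply (Rmult_le_reg_l ((6 + 4 * d + 2 * d ^ 2) ^ 2)); [positivity|].
    apply (Rle_trans _ _ _ h).
    rewrite <- Rmult_assoc, <- Rpow_mult_distr.
    apply Rmult_le_compat_r; [assumption|].
    apply pow_incr; nra.
  - assert (h := sqnorm_le_67_large d t (conj (Rlt_le _ _ hd2) (proj2 hd)) ht).
    fold l r in h.
    (* 39 / 32 = 1.21875 lies just below 1.1040686^2. *)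
    assert (39 <= 32 * C ^ 2) by nra.
    nra.
Qed.

(** * From polynomial inequalities to distances *)

(** Squaring and multiplying by c^2 c'^2 reduces the claim to the polynomial inequality times E, so
    no division by E occurs and E = 0 is covered. *)
Lemma scaled_dist_le (E q q' c c' x x' k k' : R) :
  0 <= E -> 0 < c -> 0 < c' -> 0 <= x' -> 0 <= k' ->
  c ^ 2 * x ^ 2 = E * q -> c' ^ 2 * x' ^ 2 = E * q' ->
  k ^ 2 * (c' ^ 2 * q) <= k' ^ 2 * (c ^ 2 * q') -> k * x <= k' * x'.
Proof.
  intros hE hc hc' hx' hk ex ex' hq.
  apply Rsqr_incr_0_var; [|apply Rmult_le_pos; assumption].
  rewrite !Rsqr_pow2.
  apply (Rmult_le_reg_l (c ^ 2 * c' ^ 2)); [positivity|].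
  replace (c ^ 2 * c' ^ 2 * (k * x) ^ 2) with (E * (k ^ 2 * (c' ^ 2 * q))).
  - replace (c ^ 2 * c' ^ 2 * (k' * x') ^ 2) with (E * (k' ^ 2 * (c ^ 2 * q'))).
    + apply Rmult_le_compat_l; assumption.
    + transitivity (k' ^ 2 * c ^ 2 * (E * q')); [ring|]; rewrite <- ex'; ring.
  - transitivity (k ^ 2 * c' ^ 2 * (E * q)); [ring|]; rewrite <- ex; ring.
Qed.

Ltac compare cmp i j k l :=
  apply (cmp i j k l); [lia|lia|lra|];
  bernstein 0 1 1 1 (fun d t h e =>
    l ^ 2 * (denom i d t h e ^ 2 * sqnorm j d t h e)
    - k ^ 2 * (denom j d t h e ^ 2 * sqnorm i d t h e)).

Theorem theorem4 :
  exists C3 : R,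
    unique is_positive_root C3 /\
    Rabs (C3 - 1104068697 / 10 ^ 9) < 5 / 10 ^ 10 /\
    forall A B C : point,
      is_triangle A B C ->
      (D A B C 4 1 <= D A B C 4 2 /\
       D A B C 4 1 <= 2 / 3 * D A B C 4 3 /\
       D A B C 4 1 <= 4 / 3 * D A B C 4 5 /\
       D A B C 4 6 <= D A B C 4 1 /\
       D A B C 4 7 <= D A B C 4 1 <= 2 * D A B C 4 7 /\
       D A B C 4 1 <= D A B C 4 8 /\
       D A B C 4 1 <= D A B C 4 9 /\
       D A B C 4 1 <= D A B C 4 10) /\
      (D A B C 4 2 = 2 / 3 * D A B C 4 3 /\
       D A B C 4 2 = 4 / 3 * D A B C 4 5 /\
       D A B C 4 6 <= D A B C 4 2 /\
       D A B C 4 7 <= D A B C 4 2 /\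
       1 / 3 * D A B C 4 8 <= D A B C 4 2 <= D A B C 4 8 /\
       2 / 3 * D A B C 4 9 <= D A B C 4 2 <= D A B C 4 9 /\
       2 / 3 * D A B C 4 10 <= D A B C 4 2 <= D A B C 4 10) /\
      (D A B C 4 3 = 2 * D A B C 4 5 /\
       3 / 2 * D A B C 4 6 <= D A B C 4 3 /\
       3 / 2 * D A B C 4 7 <= D A B C 4 3 /\
       1 / 2 * D A B C 4 8 <= D A B C 4 3 <= 3 / 2 * D A B C 4 8 /\
       D A B C 4 9 <= D A B C 4 3 <= 3 / 2 * D A B C 4 9 /\
       D A B C 4 10 <= D A B C 4 3 <= 3 / 2 * D A B C 4 10) /\
      (3 / 4 * D A B C 4 6 <= D A B C 4 5 /\
       3 / 4 * D A B C 4 7 <= D A B C 4 5 /\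
       1 / 4 * D A B C 4 8 <= D A B C 4 5 <= 3 / 4 * D A B C 4 8 /\
       1 / 2 * D A B C 4 9 <= D A B C 4 5 <= 3 / 4 * D A B C 4 9 /\
       1 / 2 * D A B C 4 10 <= D A B C 4 5 <= 3 / 4 * D A B C 4 10) /\
      (D A B C 4 6 <= C3 * D A B C 4 7 /\
       D A B C 4 6 <= D A B C 4 8 /\
       D A B C 4 6 <= D A B C 4 9 /\
       D A B C 4 6 <= D A B C 4 10) /\
      (D A B C 4 7 <= D A B C 4 8 /\
       D A B C 4 7 <= D A B C 4 9 /\
       D A B C 4 7 <= D A B C 4 10) /\
      (D A B C 4 9 <= D A B C 4 8 <= 2 * D A B C 4 9 /\
       D A B C 4 10 <= D A B C 4 8 <= 2 * D A B C 4 10) /\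
      (D A B C 4 10 <= D A B C 4 9 <= 10 / 9 * D A B C 4 10).
Proof.
  destruct C3_spec as (C3 & root & approx & max).
  exists C3; split; [assumption|]; split; [assumption|].
  intros A B C tri.
  destruct (center_distances A B C tri) as (E & d & t & hE & hd & ht & dists).
  assert (cmp : forall i j k l, (1 <= i <= 10)%nat -> (1 <= j <= 10)%nat -> 0 <= l ->
    0 <= l ^ 2 * (denom i d t 1 1 ^ 2 * sqnorm j d t 1 1)
         - k ^ 2 * (denom j d t 1 1 ^ 2 * sqnorm i d t 1 1) ->
    k * D A B C 4 i <= l * D A B C 4 j).
  { intros i j k l hi hj hl h.
    destruct (dists i hi) as [ci di], (dists j hj) as [cj dj].
    apply (scaled_dist_le E _ _ _ _ _ _ k l hE ci cj (dist_ge0 _ _) hl di dj); lra. }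
  (* The remaining bounds follow linearly from those below. Integer multipliers keep the Bernstein
     coefficients integral, and each equality is split into two inequalities. *)
  assert (le_6_1 : 1 * D A B C 4 6 <= 1 * D A B C 4 1)
    by compare cmp 6%nat 1%nat 1 1.
  assert (le_7_1 : 1 * D A B C 4 7 <= 1 * D A B C 4 1)
    by compare cmp 7%nat 1%nat 1 1.
  assert (le_1_7 : 1 * D A B C 4 1 <= 2 * D A B C 4 7)
    by compare cmp 1%nat 7%nat 1 2.
  assert (le_1_2 : 1 * D A B C 4 1 <= 1 * D A B C 4 2)
    by compare cmp 1%nat 2%nat 1 1.
  assert (le_2_3 : 3 * D A B C 4 2 <= 2 * D A B C 4 3)
    by compare cmp 2%nat 3%nat 3 2.
  assert (le_3_2 : 2 * D A B C 4 3 <= 3 * D A B C 4 2)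
    by compare cmp 3%nat 2%nat 2 3.
  assert (le_3_5 : 1 * D A B C 4 3 <= 2 * D A B C 4 5)
    by compare cmp 3%nat 5%nat 1 2.
  assert (le_5_3 : 2 * D A B C 4 5 <= 1 * D A B C 4 3)
    by compare cmp 5%nat 3%nat 2 1.
  assert (le_2_10 : 1 * D A B C 4 2 <= 1 * D A B C 4 10)
    by compare cmp 2%nat 10%nat 1 1.
  assert (le_10_2 : 2 * D A B C 4 10 <= 3 * D A B C 4 2)
    by compare cmp 10%nat 2%nat 2 3.
  assert (le_9_2 : 2 * D A B C 4 9 <= 3 * D A B C 4 2)
    by compare cmp 9%nat 2%nat 2 3.
  assert (le_8_2 : 1 * D A B C 4 8 <= 3 * D A B C 4 2)
    by compare cmp 8%nat 2%nat 1 3.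
  assert (le_9_8 : 1 * D A B C 4 9 <= 1 * D A B C 4 8)
    by compare cmp 9%nat 8%nat 1 1.
  assert (le_8_10 : 1 * D A B C 4 8 <= 2 * D A B C 4 10)
    by compare cmp 8%nat 10%nat 1 2.
  assert (le_10_9 : 1 * D A B C 4 10 <= 1 * D A B C 4 9)
    by compare cmp 10%nat 9%nat 1 1.
  assert (le_9_10 : 9 * D A B C 4 9 <= 10 * D A B C 4 10)
    by compare cmp 9%nat 10%nat 9 10.
  assert (le_6_7 : 1 * D A B C 4 6 <= C3 * D A B C 4 7).
  { apply Rabs_def2 in approx.
    apply cmp; [lia|lia|lra|].
    rewrite pow1, Rmult_1_l; apply Rge_le, Rge_minus, Rle_ge.
    apply sqnorm_le_67; try assumption; try lra.
    - apply max; lra.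
    - bernstein 0 1 1 1 (sqnorm 7). }
  repeat split; lra.
Qed.
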